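(* Let $J_1>J_2>0$ and $\delta>0$. There exists $\beta_0=\beta_0(\delta)<\infty$ (possibly depending on the couplings) such that for all $\beta\ge\beta_0$, every translation-invariant, ergodic infinite-volume Gibbs measure $\mu$ at inverse temperature $\beta$ satisfies $\mathbb E_\mu([S^x_{\boldsymbol r}]^2)\ge1-\delta$ for all $\boldsymbol r\in\mathbb Z^2$. Similarly, if $J_2>J_1>0$, then for $\beta\ge\beta_0(\delta)$, $\mathbb E_\mu([S^z_{\boldsymbol r}]^2)\ge1-\delta$ for all such $\mu$ and all $\boldsymbol r$.
   Context: On $\mathbb Z^2$ the horizontal edge $\langle \boldsymbol r,\boldsymbol r+\boldsymbol e_1\rangle$ is an $x$-edge if $r_1$ is even and a $z$-edge if $r_1$ is odd; the vertical edge $\langle\boldsymbol r,\boldsymbol r+\boldsymbol e_2\rangle$ is an $x$-edge if $r_2$ is even and a $z$-edge otherwise. Spins $\mathbf S_{\boldsymbol r}=(S^x_{\boldsymbol r},S^z_{\boldsymbol r})$ are unit vectors in $\mathbb R^2$ with a priori uniform measure $\nu$ on the unit circle. The formal Hamiltonian is $-J_1\sum_{x\text{-edges}}S^x_{\boldsymbol r}S^x_{\boldsymbol r'}-J_2\sum_{z\text{-edges}}S^z_{\boldsymbol r}S^z_{\boldsymbol r'}$. Infinite-volume Gibbs measures at inverse temperature $\beta$ are defined by the DLR condition: for each finite $\Lambda$, the conditional law of the spins in $\Lambda$ given those outside has density proportional to $e^{-\beta\mathcal H_\Lambda}$ w.r.t. $\prod_{\boldsymbol r\in\Lambda}\nu$,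 $\mathcal H_\Lambda$ being the sum of the interaction terms over edges with at least one endpoint in $\Lambda$. Translation invariance means invariance under shifts by $2\boldsymbol e_1$ and $2\boldsymbol e_2$; ergodicity means triviality ($\mu$-probability 0 or 1) of events invariant under these shifts. *)

(* Defs.v *)
From HB Require Import structures.
From mathcomp Require Import all_boot all_order all_algebra.
From mathcomp Require Import all_classical all_reals all_analysis.
Set Implicit Arguments. Unset Strict Implicit. Unset Printing Implicit Defensive.
Import Order.TTheory GRing.Theory Num.Theory.
Local Open Scope classical_set_scope.
Local Open Scope ring_scope.

Definition site := (int * int)%type.

(* A spin configuration: each site carries a vector (S^x, S^z) of R^2. *)
Definition spinconf (R : realType) := site -> (R * R)%type.
HB.instance Definition _ (R : realType) := Choice.on (spinconf R).
HB.instance Definition _ (R : realType) :=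
  isPointed.Build (spinconf R) (fun _ => (0%R : R, 0%R : R)).

Definition coord_events (R : realType) : set (set (spinconf R)) :=
  [set A | exists (r : site) (B : set (R * R)%type),
             measurable B /\ A = (fun w : spinconf R => w r) @^-1` B].

Notation Omega R := (g_sigma_algebraType (@coord_events R)).

Section Model.
Variable R : realType.

Definition upd (w : spinconf R) (r : site) (v : R * R) : spinconf R :=
  fun s => if s == r then v else w s.

(* Parametrization of the unit circle; the a priori measure nu is the image of
   the normalized Lebesgue measure on [0, 2 pi]. *)
Definition unitvec (t : R) : R * R := (cos t, sin t).

(* Integration of F over the spins of the sites in L against prod_{r in L} nu,
   the spins outside L being fixed by w. *)
Fixpoint integ_sites (L : seq site) (F : spinconf R -> R) (w : spinconf R) : R :=
  match L with
  | [::] => F w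
  | r :: L' => (2 * pi)^-1 *
      Rintegral lebesgue_measure (`[0, 2 * pi]%classic : set R)
        (fun t => integ_sites L' F (upd w r (unitvec t)))
  end.

Definition bondH (J1 J2 : R) (w : spinconf R) (r : site) : R :=
  let r' := (r.1 + 1, r.2)%R in
  if (2 %| r.1)%Z then - J1 * (w r).1 * (w r').1 else - J2 * (w r).2 * (w r').2.

Definition bondV (J1 J2 : R) (w : spinconf R) (r : site) : R :=
  let r' := (r.1, r.2 + 1)%R in
  if (2 %| r.2)%Z then - J1 * (w r).1 * (w r').1 else - J2 * (w r).2 * (w r').2.

(* H_Lambda: sum of the interaction terms over all edges with at least one
   endpoint in L (each such edge counted exactly once, L duplicate-free). *)
Definition H_Lambda (J1 J2 : R) (L : seq site) (w : spinconf R) : R :=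
  \sum_(r <- L)
    (bondH J1 J2 w r + bondV J1 J2 w r
     + (if ((r.1 - 1)%R, r.2) \in L then 0 else bondH J1 J2 w ((r.1 - 1)%R, r.2))
     + (if (r.1, (r.2 - 1)%R) \in L then 0 else bondV J1 J2 w (r.1, (r.2 - 1)%R))).

Definition boltz (J1 J2 beta : R) (L : seq site) (w : spinconf R) : R :=
  expR (- beta * H_Lambda J1 J2 L w).

Definition gibbs_kernel (J1 J2 beta : R) (L : seq site) (A : set (spinconf R))
  (w : spinconf R) : R :=
  integ_sites L (fun eta => \1_A eta * boltz J1 J2 beta L eta) w /
  integ_sites L (boltz J1 J2 beta L) w.

Definition is_gibbs (J1 J2 beta : R) (mu : probability (Omega R) R) : Prop :=
  forall L : seq site, uniq L ->
  forall A : set (Omega R), measurable A ->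
    mu A = (\int[mu]_w (gibbs_kernel J1 J2 beta L A w)%:E)%E.

Definition shift (a : site) (w : spinconf R) : spinconf R :=
  fun s => w ((s.1 + a.1)%R, (s.2 + a.2)%R).

Definition e1x2 : site := (2%:Z, 0%:Z).
Definition e2x2 : site := (0%:Z, 2%:Z).

Definition transl_invariant (mu : probability (Omega R) R) : Prop :=
  forall A : set (Omega R), measurable A ->
    mu (shift e1x2 @^-1` A) = mu A /\ mu (shift e2x2 @^-1` A) = mu A.

Definition ergodic (mu : probability (Omega R) R) : Prop :=
  forall A : set (Omega R), measurable A ->
    shift e1x2 @^-1` A = A -> shift e2x2 @^-1` A = A ->
    mu A = 0%E \/ mu A = 1%E.

End Model.

(* Main.v *)
Require Import Defs.
From HB Require Import structures.
From mathcomp Require Import all_boot all_order all_algebra.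
From mathcomp Require Import all_classical all_reals all_analysis.
From mathcomp Require Import measurable_realfun.
From mathcomp Require Import ring lra zify.
Set Implicit Arguments. Unset Strict Implicit. Unset Printing Implicit Defensive.
Import Order.TTheory GRing.Theory Num.Theory.
Import numFieldNormedType.Exports HBNNSimple.
Local Open Scope classical_set_scope.
Local Open Scope ring_scope.

(** Every site lies on two x-edges and two z-edges, so completing the square
in each bond turns the energy of a box, up to a boundary term, into
[- \sum_r (J1 (S^x_r)^2 + J2 (S^z_r)^2)] plus a nonnegative sum of squares of
discrete gradients.  For unit spins this is at least [- J N] plus the gap
[|J1 - J2|] times the sum of the squares of the minority components, where [J]
is the larger coupling and [N] the number of sites.  On the other hand, spins
confined to a small arc around the majority direction have energy close to
[- J N], whatever the boundary condition, so the partition function is at least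
[exp (beta (J - small) N)] times [c ^ N], [c] being the normalized arc length.
In a large fixed box the DLR equation then makes the event that the minority components
have a large mean square exponentially unlikely in [beta], and translation
invariance converts this into a bound at a single site. *)

(** * Bounds on iterated integrals *)

(* Nonnegative integrals are suprema over simple functions, so the smaller
   integrand need not be measurable; this spares a proof that the kernels are
   measurable functions of the boundary condition. *)

Section IntegralBounds.
Context d (T : measurableType d) (R : realType).
Variable mu : {measure set T -> \bar R}.
Local Open Scope ereal_scope.

Lemma nonmeas_le_integral (D : set T) (f g : T -> \bar R) :
  (forall x, D x -> 0 <= f x) -> (forall x, D x -> f x <= g x) ->
  \int[mu]_(x in D) f x <= \int[mu]_(x in D) g x.
Proof.
move=> f0 fg.
have g0 x : D x -> 0 <= g x by move=> Dx; exact: le_trans (f0 _ Dx) (fg _ Dx).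
rewrite !ge0_integralE//; apply: le_ereal_sup => _ /= [h hf <-].
exists h => // x; apply: le_trans (hf x) _.
by rewrite /patch; case: ifPn => // /set_mem; exact: fg.
Qed.

(** Each simple function below [f] has the same integral off the null set [N], and there it lies
    below [g]. In the applications [N] is the set of configurations with a spin off the unit
    circle. *)
Lemma nonmeas_ae_le_integral (N : set T) (f g : T -> \bar R) :
  measurable N -> mu N = 0 -> measurable_fun setT g ->
  (forall x, 0 <= f x) -> (forall x, 0 <= g x) ->
  (forall x, ~ N x -> f x <= g x) ->
  \int[mu]_x f x <= \int[mu]_x g x.
Proof.
move=> mN N0 mg f0 g0 fg.
rewrite ge0_integralE//; apply: ge_ereal_sup => _ /= [h hf <-].
have -> : sintegral mu h = \int[mu]_x (h x)%:E.
  by rewrite integral_nnsfun// patch_setT.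
rewrite (@ge0_negligible_integral _ _ _ mu _ N)//; last 2 first.
- exact/measurable_EFinP.
- by move=> x _; rewrite lee_fin.
apply: (@le_trans _ _ (\int[mu]_(x in setT `\` N) g x)).
  apply: nonmeas_le_integral => x [_ Nx]; first by rewrite lee_fin.
  by apply: le_trans (fg _ Nx); have := hf x; rewrite patch_setT.
by apply: ge0_subset_integral => //; exact: measurableD.
Qed.

End IntegralBounds.

(** * Averages over one spin *)

Section CircleAverage.
Variable R : realType.

(** One layer of the recursion in [integ_sites]. *)
Definition circle_avg (f : R -> R) : R :=
  (2 * pi)^-1 *
  Rintegral lebesgue_measure (`[0, 2 * pi]%classic : set R) f.

Let twopi_gt0 : 0 < 2 * pi :> R.
Proof. by rewrite mulr_gt0// pi_gt0. Qed.

Lemma circle_avg_ge0 (f : R -> R) : (forall t, 0 <= f t) -> 0 <= circle_avg f.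
Proof.
move=> f0; apply: mulr_ge0; first by rewrite invr_ge0 ltW.
by apply: fine_ge0; apply: integral_ge0 => t _; rewrite lee_fin.
Qed.

Let int_le (f : R -> R) M : (forall t, 0 <= f t <= M) ->
  (\int[lebesgue_measure]_(t in `[0%R, (2 * pi)%R]) (f t)%:E <= (M * (2 * pi))%:E)%E.
Proof.
move=> fM.
apply: (@le_trans _ _ (\int[lebesgue_measure]_(t in `[0%R, (2 * pi)%R]) (cst M%:E) t)%E).
  apply: nonmeas_le_integral => t _; rewrite lee_fin; by case/andP: (fM t).
by rewrite integral_cst//= lebesgue_measure_itv/= lte_fin twopi_gt0 sube0 EFinM.
Qed.

Lemma circle_avg_le (f : R -> R) M :
  (forall t, 0 <= f t <= M) -> circle_avg f <= M.
Proof.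
move=> fM; rewrite /circle_avg mulrC ler_pdivrMr// -lee_fin.
rewrite /Rintegral fineK; first exact: int_le.
rewrite ge0_fin_numE; first by rewrite (le_lt_trans (int_le fM))// ltry.
by apply: integral_ge0 => t _; rewrite lee_fin; case/andP: (fM t).
Qed.

(** [f] dominates [m] times the indicator of the arc. The bound [M] makes the integral finite;
    [Rintegral] would send an infinite one to 0. *)
Lemma circle_avg_ge_arc (f : R -> R) M m (a0 a1 : R) :
  0 <= a0 -> a0 < a1 -> a1 <= 2 * pi -> 0 <= m ->
  (forall t, 0 <= f t <= M) -> (forall t, a0 <= t <= a1 -> m <= f t) ->
  m * ((a1 - a0) / (2 * pi)) <= circle_avg f.
Proof.
move=> a00 a01 a1pi m0 fM fm.
rewrite mulrA mulrC /circle_avg ler_pM2l ?invr_gt0// -lee_fin.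
have f0 t : 0 <= f t by case/andP: (fM t).
rewrite /Rintegral fineK; last first.
  rewrite ge0_fin_numE; first by rewrite (le_lt_trans (int_le fM))// ltry.
  by apply: integral_ge0 => t _; rewrite lee_fin.
have -> : ((m * (a1 - a0))%:E =
    \int[lebesgue_measure]_(t in `[0%R, (2 * pi)%R])
      (m * \1_(`[a0, a1]%classic) t)%:E)%E.
  under eq_integral do rewrite EFinM.
  rewrite ge0_integralZl//; last first.
    exact/measurable_EFinP/measurable_indic.
  rewrite integral_indic//=.
  rewrite (_ : `[a0, a1] `&` `[0, 2 * pi] = `[a0, a1])%classic; last first.
    apply/setIidl => t /=; rewrite !in_itv/= => /andP[h1 h2].
    by apply/andP; split; lra.
  by rewrite lebesgue_measure_itv/= lte_fin a01 -EFinB -EFinM.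
apply: nonmeas_le_integral => t _; rewrite lee_fin.
  by rewrite mulr_ge0.
rewrite indicE; case: (boolP (t \in _)) => [|_]; last by rewrite mulr0.
by rewrite inE/= in_itv/= mulr1; exact: fm.
Qed.

End CircleAverage.

(** * Averages over the spins of a finite set of sites *)

Section FiniteVolumeBounds.
Variable R : realType.
Implicit Types (w : spinconf R) (L : seq site) (F : spinconf R -> R).

Definition unit_spin (v : R * R) : Prop := v.1 ^+ 2 + v.2 ^+ 2 = 1.

Definition unit_conf w : Prop := forall r, unit_spin (w r).

Lemma unit_unitvec (t : R) : unit_spin (unitvec t).
Proof. exact: cos2Dsin2. Qed.

Lemma unit_upd w r t : unit_conf w -> unit_conf (upd w r (unitvec t)).
Proof. by move=> uw s; rewrite /upd; case: eqP => // _; exact: unit_unitvec. Qed.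

Lemma integ_sites_ge0 L F w : (forall w', 0 <= F w') -> 0 <= integ_sites L F w.
Proof.
move=> F0; elim: L w => [|r L IH] w //=.
by apply: circle_avg_ge0 => t; exact: IH.
Qed.

Lemma integ_sites_le L F M w : unit_conf w -> (forall w', 0 <= F w') ->
  (forall w', unit_conf w' -> F w' <= M) -> integ_sites L F w <= M.
Proof.
move=> uw F0 FM; elim: L w uw => [|r L IH] w uw /=; first exact: FM.
apply: circle_avg_le => t; rewrite integ_sites_ge0//=.
by apply: IH; exact: unit_upd.
Qed.

(** Confining each spin of [L] to the arc costs one factor, the normalized arc length, per site. *)
Lemma integ_sites_ge_arc L F M m (a0 a1 : R) w : unit_conf w ->
  0 <= a0 -> a0 < a1 -> a1 <= 2 * pi -> 0 <= m ->
  (forall w', 0 <= F w') -> (forall w', unit_conf w' -> F w' <= M) ->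
  (forall w', unit_conf w' ->
    (forall s, s \in L -> exists2 t, a0 <= t <= a1 & w' s = unitvec t) ->
    m <= F w') ->
  m * ((a1 - a0) / (2 * pi)) ^+ size L <= integ_sites L F w.
Proof.
move=> uw a00 a01 a1pi m0 F0 FM.
have c0 : 0 <= (a1 - a0) / (2 * pi).
  by rewrite mulr_ge0 ?invr_ge0 ?mulr_ge0 ?pi_ge0// subr_ge0 ltW.
(* The induction remembers that [w'] agrees with [w] off [L']; this carries the angle chosen at an
   outer site through the inner integrations. *)
suff H L' : forall w, unit_conf w ->
    (forall w', unit_conf w' -> (forall s, s \notin L' -> w' s = w s) ->
      (forall s, s \in L' -> exists2 t, a0 <= t <= a1 & w' s = unitvec t) ->
      m <= F w') ->
    m * ((a1 - a0) / (2 * pi)) ^+ size L' <= integ_sites L' F w.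
  by move=> Fm; apply: H => // w' uw' _; exact: Fm.
elim: L' => [|r L' IH] {}w {}uw Fm /=.
  by rewrite expr0 mulr1; apply: Fm.
rewrite exprSr [leLHS]mulrA.
apply: (@circle_avg_ge_arc _ _ M _ a0 a1) => //.
- by rewrite mulr_ge0// exprn_ge0.
- move=> t; rewrite integ_sites_ge0//=; apply: integ_sites_le => //.
  exact: unit_upd.
move=> t ht; apply: IH; first exact: unit_upd.
move=> w' uw' out inn; apply: Fm => // s.
  rewrite inE negb_or => /andP[sr sL]; rewrite out// /upd.
  by rewrite (negbTE sr).
rewrite inE; have [/inn//|sL] := boolP (s \in L').
by rewrite orbF => /eqP sr; exists t => //; rewrite out// /upd sr eqxx.
Qed.

End FiniteVolumeBounds.

(** * Energy of a box *)

Lemma natr_mul_sum (R : pzRingType) n (c : R) : n%:R * c = \sum_(i < n) c.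
Proof. by rewrite sumr_const card_ord mulr_natl. Qed.

Section Energy.
Variables (R : realType) (J1 J2 : R).
Hypotheses (J1_gt0 : 0 < J1) (J2_gt0 : 0 < J2).
Implicit Types (w : spinconf R) (v : R * R) (b p : bool).

(** The boolean [true] stands for the x-component and its coupling, [false] for z. Below, [p] is the
    majority direction, so that both halves of the theorem are instances of one statement. *)
Definition spin_comp b v : R := if b then v.1 else v.2.
Definition coupling b : R := if b then J1 else J2.
(* Each site has exactly one edge of either type in each direction, so the bonds
   of a row share out half of [J1 x^2 + J2 z^2] to every site. *)
Definition half_energy b v : R := coupling b * spin_comp b v ^+ 2 / 2.
Definition site_energy v : R := half_energy true v + half_energy false v.
Definition bond b v v' : R := - coupling b * spin_comp b v * spin_comp b v'.

Let K := J1 + J2.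

Definition x_type (i : int) : bool := (2 %| i)%Z.

Lemma x_typeS i : x_type (i + 1) = ~~ x_type i.
Proof. rewrite /x_type; lia. Qed.

Lemma coupling_gt0 b : 0 < coupling b. Proof. by case: b. Qed.

Lemma coupling_leK b : coupling b <= K.
Proof. by rewrite /K /coupling; case: b; rewrite (lerDl, lerDr) ltW. Qed.

Lemma comp_sqr p v : unit_spin v -> spin_comp p v ^+ 2 = 1 - spin_comp (~~ p) v ^+ 2.
Proof. by rewrite /unit_spin; case: p => /= <-; ring. Qed.

Lemma comp_sqr_le1 p v : unit_spin v -> spin_comp p v ^+ 2 <= 1.
Proof. by move/(comp_sqr p) => ->; rewrite gerBl sqr_ge0. Qed.

Lemma half_energy_bounds b v : unit_spin v -> 0 <= half_energy b v <= K / 2.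
Proof.
move=> uv; have := comp_sqr_le1 b uv; have := coupling_gt0 b.
have := coupling_leK b; have := sqr_ge0 (spin_comp b v).
rewrite /half_energy; set s := _ ^+ 2 => *; apply/andP; split; nra.
Qed.

(** The unit length eliminates the majority component. The factor 1/2 is there because a site is
    counted once in its row and once in its column. *)
Lemma site_energyE p v : unit_spin v ->
  site_energy v = (coupling p
    - (coupling p - coupling (~~ p)) * spin_comp (~~ p) v ^+ 2) / 2.
Proof.
move=> uv; rewrite /site_energy /half_energy.
by case: p; rewrite /= ?(comp_sqr true uv) ?(comp_sqr false uv) /=; field.
Qed.

Lemma bondE b v v' : bond b v v' = - (half_energy b v + half_energy b v')
  + coupling b / 2 * (spin_comp b v - spin_comp b v') ^+ 2.
Proof. by rewrite /bond /half_energy; field. Qed.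

Lemma bond_ge b v v' : - (half_energy b v + half_energy b v') <= bond b v v'.
Proof.
by rewrite bondE lerDl mulr_ge0 ?sqr_ge0// divr_ge0// ltW// coupling_gt0.
Qed.

Lemma bond_norm b v v' : unit_spin v -> unit_spin v' -> `|bond b v v'| <= K.
Proof.
move=> uv uv'; rewrite ler_norml.
have := bond_ge b v v'; have /andP[_] := half_energy_bounds b uv.
have /andP[_] := half_energy_bounds b uv'.
rewrite /bond; set c := spin_comp b v; set c' := spin_comp b v'.
have : c * c' * coupling b >= - K.
  have c0 := coupling_gt0 b; have cK := coupling_leK b.
  have := comp_sqr_le1 b uv; have := comp_sqr_le1 b uv'.
  rewrite -/c -/c' => h1 h2.
  have : -1 <= c * c' by nra.
  nra.
rewrite [c * _ * _]mulrC !mulNr !mulrA => *; lra.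
Qed.

(** Two unit spins near the majority direction are close in both components, so the square completed
    in [bondE] is at most [8 * e]. *)
Lemma bond_le_aligned p e b v v' : unit_spin v -> unit_spin v' ->
  1 - e <= spin_comp p v -> 1 - e <= spin_comp p v' ->
  bond b v v' <= - (half_energy b v + half_energy b v') + 4 * e * K.
Proof.
move=> uv uv' hv hv'; rewrite bondE lerD2l.
suff h : (spin_comp b v - spin_comp b v') ^+ 2 <= 8 * e.
  have := coupling_gt0 b; have := coupling_leK b.
  have := sqr_ge0 (spin_comp b v - spin_comp b v'); nra.
have := comp_sqr (~~ p) uv; have := comp_sqr (~~ p) uv'.
rewrite negbK => q q'.
have l1 := comp_sqr_le1 p uv; have l2 := comp_sqr_le1 p uv'.
have [->|->] : b = p \/ b = ~~ p by case: b; case: p {hv hv' q q' l1 l2}; [left|right|right|left].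
  have : 0 <= (1 - spin_comp p v) * (1 - spin_comp p v') by apply: mulr_ge0; nra.
  have : spin_comp p v <= 1 by nra.
  rewrite sqrrB; lra.
(* Both minority squares are at most [2 * e], and the square of a difference is at most twice the
   sum of the squares. *)
have : spin_comp p v ^+ 2 >= 1 - 2 * e by have := sqr_ge0 (1 - spin_comp p v); lra.
have : spin_comp p v' ^+ 2 >= 1 - 2 * e by have := sqr_ge0 (1 - spin_comp p v'); lra.
have := sqr_ge0 (spin_comp (~~ p) v + spin_comp (~~ p) v'); rewrite sqrrD sqrrB; lra.
Qed.

(** * Energy of a one-dimensional chain with alternating bond types, used for rows and columns
    alike *)

Section Row.
Variables (s : int -> R * R) (a : int).
Hypothesis us : forall i, unit_spin (s i).

Let sa (i : nat) := s (a + i%:Z).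
Let e (i : nat) := bond (x_type (a + i%:Z)) (s (a + i%:Z)) (s (a + i%:Z + 1)).
Let h (i : nat) := half_energy (x_type (a + i%:Z)) (s (a + i%:Z))
  + half_energy (x_type (a + i%:Z)) (s (a + i%:Z + 1)).

Let addS (i : nat) : a + i.+1%:Z = a + i%:Z + 1.
Proof. lia. Qed.

(** Since types alternate, an inner site receives one half-energy of each type. At the ends, the
    last bond reaches the site [n] past the sum, and the first site lacks the bond on its left. *)
Lemma row_telescope n : \sum_(i < n) h i = \sum_(i < n) site_energy (sa i)
  + half_energy (~~ x_type (a + n%:Z)) (sa n) - half_energy (~~ x_type a) (s a).
Proof.
elim: n => [|n IH]; first by rewrite !big_ord0 /sa addr0; ring.
rewrite !big_ord_recr/= IH /h /sa addS x_typeS negbK /site_energy.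
by case: (x_type (a + n%:Z)) => /=; ring.
Qed.

Let row_error n : `|\sum_(i < n) h i - \sum_(i < n) site_energy (sa i)| <= K / 2.
Proof.
rewrite row_telescope ler_norml.
have /andP[] := half_energy_bounds (~~ x_type (a + n%:Z)) (us (a + n%:Z)).
have /andP[] := half_energy_bounds (~~ x_type a) (us a).
rewrite /sa => *; lra.
Qed.

Lemma row_energy_ge p n :
  n%:R * (- coupling p / 2) + (coupling p - coupling (~~ p)) / 2 *
    \sum_(i < n) spin_comp (~~ p) (sa i) ^+ 2 - K <= \sum_(i < n) e i.
Proof.
have h1 : - \sum_(i < n) h i <= \sum_(i < n) e i.
  by rewrite -sumrN; apply: ler_sum => i _; exact: bond_ge.
have := row_error n; rewrite ler_norml => /andP[_ h2].
have : \sum_(i < n) site_energy (sa i) = n%:R * (coupling p / 2) -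
   (coupling p - coupling (~~ p)) / 2 * \sum_(i < n) spin_comp (~~ p) (sa i) ^+ 2.
  rewrite mulr_sumr natr_mul_sum -sumrB; apply: eq_bigr => i _.
  by rewrite (site_energyE p (us _)); field.
have : 0 < K by rewrite addr_gt0.
move=> *; lra.
Qed.

(** Of the [5 * eps * K] per site, 4 come from the completed squares and 1 from the site energies.
    The last bond leads to a spin not assumed aligned and costs at most [2 * K]; telescoping costs
    [K / 2]. *)
Lemma row_energy_le p n eps : 0 <= eps ->
  (forall i, (i < n)%N -> 1 - eps <= spin_comp p (sa i)) ->
  \sum_(i < n) e i <= n%:R * (- coupling p / 2 + 5 * eps * K) + 3 * K.
Proof.
move=> e0 al; have K0 : 0 < K by rewrite addr_gt0.
have h1 : \sum_(i < n) e i <= - \sum_(i < n) h i + n%:R * (4 * eps * K) + 2 * K.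
  case: n al => [|n] al; first by rewrite !big_ord0; lra.
  rewrite !big_ord_recr/= -natr1.
  have : \sum_(i < n) e i <= - \sum_(i < n) h i + n%:R * (4 * eps * K).
    rewrite natr_mul_sum -sumrN -big_split/=.
    apply: ler_sum => i _; apply: (@bond_le_aligned p) => //.
      by apply: al; rewrite ltnS ltnW.
    by have := al i.+1; rewrite /sa addS ltnS; apply.
  have := bond_norm (x_type (a + n%:Z)) (us (a + n%:Z)) (us (a + n%:Z + 1)).
  have /andP[] := half_energy_bounds (x_type (a + n%:Z)) (us (a + n%:Z)).
  have /andP[] := half_energy_bounds (x_type (a + n%:Z)) (us (a + n%:Z + 1)).
  rewrite ler_norml -/(e n) => h1 h2 h3 h4 /andP[_ h5] h6.
  have : h n <= K by rewrite /h; lra.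
  have : 0 <= eps * K by rewrite mulr_ge0// ltW.
  move=> *; lra.
have := row_error n; rewrite ler_norml => /andP[h2 _].
have : n%:R * (coupling p / 2 - eps * K) <= \sum_(i < n) site_energy (sa i).
  rewrite natr_mul_sum.
  apply: ler_sum => i _.
  have := al i (ltn_ord i); have ui := us (a + i%:Z).
  have /andP[q _] := half_energy_bounds (~~ p) ui.
  have : site_energy (sa i) = half_energy p (sa i) + half_energy (~~ p) (sa i).
    by rewrite /site_energy; case: p {al q} => //=; rewrite addrC.
  move=> ->; rewrite -/(sa i) in q *; rewrite {1}/half_energy.
  have := coupling_gt0 p; have := coupling_leK p.
  set c := spin_comp p _ => cK c0 hc.
  have : 1 - 2 * eps <= c ^+ 2 by have := sqr_ge0 (1 - c); lra.
  nra.
move=> *; lra.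
Qed.

End Row.

(** * Energy of a square box *)

Definition box (a : site) (n : nat) : seq site :=
  [seq (a.1 + i%:Z, a.2 + j%:Z) | i <- index_iota 0 n, j <- index_iota 0 n].

Lemma uniq_box a n : uniq (box a n).
Proof.
apply: allpairs_uniq; rewrite ?iota_uniq// => -[i j] [i' j'] _ _ /= [].
by move=> /addrI[->] /addrI[->].
Qed.

Lemma size_box a n : size (box a n) = (n * n)%N.
Proof. by rewrite size_allpairs !size_iota subn0. Qed.

Lemma mem_box a n (i j : nat) : (i < n)%N -> (j < n)%N ->
  (a.1 + i%:Z, a.2 + j%:Z) \in box a n.
Proof. by move=> hi hj; apply/allpairsP; exists (i, j); rewrite !mem_index_iota. Qed.

Lemma sum_box (F : site -> R) a n : \sum_(r <- box a n) F r =
  \sum_(i < n) \sum_(j < n) F (a.1 + i%:Z, a.2 + j%:Z).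
Proof.
rewrite big_allpairs_dep big_mkord; apply: eq_bigr => i _.
by rewrite big_mkord.
Qed.

Lemma bondHE w r :
  bondH J1 J2 w r = bond (x_type r.1) (w r) (w (r.1 + 1, r.2)).
Proof. by rewrite /bondH /bond /x_type; case: (_ %| _)%Z. Qed.

Lemma bondVE w r :
  bondV J1 J2 w r = bond (x_type r.2) (w r) (w (r.1, r.2 + 1)).
Proof. by rewrite /bondV /bond /x_type; case: (_ %| _)%Z. Qed.

Let sum_first_row n : \sum_(i < n) \sum_(j < n) (if i == 0%N :> nat then K else 0) <= n%:R * K.
Proof.
case: n => [|n]; first by rewrite big_ord0 mul0r.
rewrite big_ord_recl/= [X in _ + X]big1; last by move=> i _; exact: big1.
by rewrite addr0 natr_mul_sum.
Qed.

(** The double sums hold the bonds leaving each site to the right and upwards. [H_Lambda] adds only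
    those entering through the left column and the bottom row: [2 * n] bonds of size at most [K]. *)
Lemma boundary_energy w a n : unit_conf w ->
  `|H_Lambda J1 J2 (box a n) w -
    (\sum_(i < n) \sum_(j < n) bondH J1 J2 w (a.1 + i%:Z, a.2 + j%:Z) +
     \sum_(i < n) \sum_(j < n) bondV J1 J2 w (a.1 + i%:Z, a.2 + j%:Z))|
  <= 2 * n%:R * K.
Proof.
move=> uw; rewrite /H_Lambda sum_box.
rewrite -big_split -sumrB/=.
under eq_bigr do rewrite -big_split -sumrB/=.
apply: le_trans (ler_norm_sum _ _ _) _.
apply: (@le_trans _ _ (\sum_(i < n) \sum_(j < n)
   ((if i == 0%N :> nat then K else 0) + (if j == 0%N :> nat then K else 0)))).
  apply: ler_sum => i _; apply: le_trans (ler_norm_sum _ _ _) _.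
  apply: ler_sum => j _.
  rewrite -[X in `|X - _|]addrA [X in `|X|]addrC addKr.
  apply: le_trans (ler_normD _ _) _; apply: lerD.
    case: ifPn => [|h]; first by rewrite normr0; case: ifP => //; rewrite addr_ge0// ltW.
    case: eqP => [_|/eqP i0]; first by rewrite bondHE bond_norm.
    (* Away from the first column the left neighbour is in the box, so no bond is added. *)
    case/negP: h; have -> : a.1 + i%:Z - 1 = a.1 + i.-1%:Z by lia.
    by apply: mem_box => //; have := ltn_ord i; lia.
  case: ifPn => [|h]; first by rewrite normr0; case: ifP => //; rewrite addr_ge0// ltW.
  case: eqP => [_|/eqP i0]; first by rewrite bondVE bond_norm.
  case/negP: h; have -> : a.2 + j%:Z - 1 = a.2 + j.-1%:Z by lia.
  by apply: mem_box => //; have := ltn_ord j; lia.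
under eq_bigr do rewrite big_split/=.
rewrite big_split/= [X in _ + X]exchange_big/=.
have := sum_first_row n; lra.
Qed.

(** Sums the row bound over [n] rows and [n] columns, with error [K] each; the entering bonds
    account for the other [2 * n * K]. *)
Lemma box_energy_ge p w a n : unit_conf w ->
  - coupling p * n%:R ^+ 2 + (coupling p - coupling (~~ p)) *
    \sum_(i < n) \sum_(j < n) spin_comp (~~ p) (w (a.1 + i%:Z, a.2 + j%:Z)) ^+ 2
    - 4 * n%:R * K <= H_Lambda J1 J2 (box a n) w.
Proof.
move=> uw; have := boundary_energy a n uw; rewrite ler_norml => /andP[h _].
set X := \sum_(i < n) _.
set g := coupling p - coupling (~~ p).
have hH : n%:R * (n%:R * (- coupling p / 2)) + g / 2 * X - n%:R * K <=
    \sum_(i < n) \sum_(j < n) bondH J1 J2 w (a.1 + i%:Z, a.2 + j%:Z).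
  rewrite [leRHS]exchange_big /X [in leLHS]exchange_big/=.
  rewrite [n%:R * (_ * _)]natr_mul_sum [n%:R * K]natr_mul_sum.
  rewrite mulr_sumr -big_split -sumrB/=.
  apply: ler_sum => j _.
  under [X in _ <= X]eq_bigr do rewrite bondHE.
  exact: (@row_energy_ge (fun i => w (i, a.2 + j%:Z)) a.1).
have hV : n%:R * (n%:R * (- coupling p / 2)) + g / 2 * X - n%:R * K <=
    \sum_(i < n) \sum_(j < n) bondV J1 J2 w (a.1 + i%:Z, a.2 + j%:Z).
  rewrite [n%:R * (_ * _)]natr_mul_sum [n%:R * K]natr_mul_sum.
  rewrite mulr_sumr -big_split -sumrB/=.
  apply: ler_sum => i _.
  under [X in _ <= X]eq_bigr do rewrite bondVE.
  exact: (@row_energy_ge (fun j => w (a.1 + i%:Z, j)) a.2).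
lra.
Qed.

(** Only spins in the box are aligned; the outside is arbitrary. The error [8 * n * K] is [3 * K]
    for each of the [2 * n] lines plus [2 * n * K] for the entering bonds. *)
Lemma box_energy_le p w a n eps : unit_conf w -> 0 <= eps ->
  (forall r, r \in box a n -> 1 - eps <= spin_comp p (w r)) ->
  H_Lambda J1 J2 (box a n) w <=
  - coupling p * n%:R ^+ 2 + 10 * eps * K * n%:R ^+ 2 + 8 * n%:R * K.
Proof.
move=> uw e0 al; have := boundary_energy a n uw; rewrite ler_norml => /andP[_ h].
have hH : \sum_(i < n) \sum_(j < n) bondH J1 J2 w (a.1 + i%:Z, a.2 + j%:Z)
    <= n%:R * (n%:R * (- coupling p / 2 + 5 * eps * K) + 3 * K).
  rewrite [X in X <= _]exchange_big/=.
  rewrite [leRHS]natr_mul_sum.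
  apply: ler_sum => j _.
  under [X in X <= _]eq_bigr do rewrite bondHE.
  apply: (@row_energy_le (fun i => w (i, a.2 + j%:Z)) a.1) => // i hi.
  by apply: al; exact: mem_box.
have hV : \sum_(i < n) \sum_(j < n) bondV J1 J2 w (a.1 + i%:Z, a.2 + j%:Z)
    <= n%:R * (n%:R * (- coupling p / 2 + 5 * eps * K) + 3 * K).
  rewrite [leRHS]natr_mul_sum.
  apply: ler_sum => i _.
  under [X in X <= _]eq_bigr do rewrite bondVE.
  apply: (@row_energy_le (fun j => w (a.1 + i%:Z, j)) a.2) => // j hj.
  by apply: al; exact: mem_box.
lra.
Qed.

End Energy.

(** * Gibbs measures *)

Section Measurability.
Variable R : realType.

Lemma measurable_eval (r : site) :
  measurable_fun [set: Omega R] (fun w : Omega R => (w : spinconf R) r).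
Proof. by move=> _ B mB; rewrite setTI; apply: sub_sigma_algebra; exists r, B. Qed.

Lemma measurable_spin_comp b : measurable_fun setT (@spin_comp R b).
Proof. by case: b; [exact: measurable_fst|exact: measurable_snd]. Qed.

Lemma measurable_comp_sqr b r :
  measurable_fun [set: Omega R] (fun w : Omega R => spin_comp b ((w : spinconf R) r) ^+ 2).
Proof.
apply: measurable_funX; apply: (measurableT_comp (@measurable_spin_comp b)).
exact: measurable_eval.
Qed.

Lemma measurable_shift (a : site) :
  measurable_fun [set: Omega R] (Defs.shift a : Omega R -> Omega R).
Proof.
refine (@measurability _ _ (Omega R) (Omega R) setT _ (@coord_events R) erefl _).
move=> _ [_ [r [C [mC ->]]] <-]; rewrite setTI.
by apply: sub_sigma_algebra; exists (r.1 + a.1, r.2 + a.2), C.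
Qed.

Lemma integral_shift (mu : probability (Omega R) R) (a : site) (f : Omega R -> \bar R) :
  (forall A : set (Omega R), measurable A -> mu (Defs.shift a @^-1` A) = mu A) ->
  measurable_fun setT f -> (forall w, 0 <= f w)%E ->
  (\int[mu]_w f (Defs.shift a w) = \int[mu]_w f w)%E.
Proof.
move=> inv mf f0.
have := @ge0_integral_pushforward _ _ _ _ R _ (@measurable_shift a) mu setT f
  measurableT mf (fun w _ => f0 w).
rewrite preimage_setT => <-.
apply: eq_measure_integral => [|mS A mA _]; last exact: inv.
exact: measurable_shift.
Qed.

Lemma integral_site_even_shift (mu : probability (Omega R) R) b (r : site) (i j : nat) :
  transl_invariant mu ->
  (\int[mu]_w (spin_comp b ((w : spinconf R) (r.1 + i.*2%:Z, r.2 + j.*2%:Z)%R) ^+ 2)%:E =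
   \int[mu]_w (spin_comp b ((w : spinconf R) r) ^+ 2)%:E)%E.
Proof.
move=> ti; pose f s (w : Omega R) : \bar R := (spin_comp b ((w : spinconf R) s) ^+ 2)%:E.
have mf s : measurable_fun setT (f s) by apply/measurable_EFinP; exact: measurable_comp_sqr.
have f0 s w : (0 <= f s w)%E by rewrite lee_fin sqr_ge0.
have inv a : (forall A : set (Omega R), measurable A -> mu (Defs.shift a @^-1` A) = mu A) ->
    forall s, (\int[mu]_w f (s.1 + a.1, s.2 + a.2)%R w = \int[mu]_w f s w)%E.
  by move=> h s; rewrite -(integral_shift h (mf s) (f0 s)).
pose E s := (\int[mu]_w f s w)%E.
have inv1 s : E (s.1 + 2, s.2) = E s.
  by rewrite -[RHS](inv _ (fun A mA => (ti A mA).1) s)/= addr0.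
have inv2 s : E (s.1, s.2 + 2) = E s.
  by rewrite -[RHS](inv _ (fun A mA => (ti A mA).2) s)/= addr0.
change (E (r.1 + i.*2%:Z, r.2 + j.*2%:Z) = E r).
elim: i => [|i <-].
  rewrite addr0; elim: j => [|j <-]; first by rewrite addr0; case: r.
  rewrite -[RHS]inv2 /=; congr (E (_, _)); lia.
rewrite -[RHS]inv1 /=; congr (E (_, _)); lia.
Qed.

(** Configurations take values in the whole plane; that spins have unit length almost surely must be
    drawn from the DLR equation. *)
Definition non_unit : set (Omega R) := [set w | ~ unit_conf (w : spinconf R)].

Let non_unit_at (r : site) : set (Omega R) :=
  [set w | ~ unit_spin ((w : spinconf R) r)].

Let measurable_non_unit_at r : measurable (non_unit_at r).
Proof.
pose f (w : Omega R) :=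
  spin_comp true ((w : spinconf R) r) ^+ 2 + spin_comp false ((w : spinconf R) r) ^+ 2.
have mf : measurable_fun setT f by apply: measurable_funD; exact: measurable_comp_sqr.
have -> : non_unit_at r = ~` (f @^-1` [set 1]) by [].
by apply: measurableC; rewrite -[X in measurable X]setTI; exact: mf.
Qed.

Let non_unitE : non_unit = \bigcup_k
  (if (unpickle k : option site) is Some r then non_unit_at r else set0).
Proof.
apply/seteqP; split => w.
  move=> /existsNP[r wr]; exists (pickle r); [exact: I|rewrite pickleK; exact: wr].
by case=> k _; case: unpickle => // r wr uw; apply: wr; exact: uw.
Qed.

Lemma measurable_non_unit : measurable non_unit.
Proof. by rewrite non_unitE; apply: bigcupT_measurable => k; case: unpickle. Qed.

(** The kernel of a single site resamples its spin on the circle, so it gives weight 0 to a non-unit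
    spin there; the sites are countable. *)
Lemma gibbs_non_unit J1 J2 beta (mu : probability (Omega R) R) :
  is_gibbs J1 J2 beta mu -> mu non_unit = 0%E.
Proof.
move=> gmu.
have H r : mu (non_unit_at r) = 0%E.
  rewrite (gmu [:: r])//.
  rewrite (_ : (fun w => _) = cst 0%E) ?integral0//; apply/funext => w /=.
  rewrite /gibbs_kernel /= (_ : (fun t : R => _) = cst 0).
    by rewrite Rintegral_cst//= mul0r mulr0 mul0r.
  apply/funext => t /=; rewrite indicE memNset ?mul0r// => /=.
  by apply; rewrite /upd eqxx; exact: unit_unitvec.
apply: (negligibleP mu measurable_non_unit).1.
rewrite non_unitE; apply: negligible_bigcup => k.
case: unpickle => [r|]; last exact: negligible_set0.
exact: (negligibleP mu (measurable_non_unit_at r)).2 (H r).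
Qed.

End Measurability.

(** * Energy estimates for the Gibbs kernel *)

Section GibbsBound.
Variable R : realType.

Lemma continuous_gt_itv (f : R -> R) x c : {for x, continuous f} -> c < f x ->
  exists2 d, 0 < d & forall t, `|x - t| <= d -> c <= f t.
Proof.
move=> cf cx.
have /nbhs_ballP[d /= d0 H] : \forall t \near x, c < f t.
  exact: (cvgr_gt _ cf).
exists (d / 2); first by rewrite divr_gt0.
move=> t xt; apply/ltW/H; rewrite /ball/=; lra.
Qed.

(** By continuity of the component near the angle where it equals 1: 0 for x, [pi / 2] for z. The
    arc starts at that angle, so that it stays inside the parameter interval. *)
Lemma aligned_arc p (eps : R) : 0 < eps -> exists a0 a1 : R,
  [/\ 0 <= a0, a0 < a1, a1 <= 2 * pi &
      forall t, a0 <= t <= a1 -> 1 - eps <= spin_comp p (unitvec t)].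
Proof.
move=> e0; have pi0 := pi_gt0 R.
suff [x [d [x0 xpi d0 H]]] : exists x d, [/\ 0 <= x, x < 2 * pi, 0 < d &
    forall t, `|x - t| <= d -> 1 - eps <= spin_comp p (unitvec t)].
  exists x, (Num.min (x + d) (2 * pi)); split => //.
  - by rewrite lt_min xpi andbT ltrDl.
  - by rewrite ge_min lexx orbT.
  - move=> t /andP[xt]; rewrite le_min => /andP[td _]; apply: H.
    by rewrite distrC ger0_norm; lra.
case: p => /=.
  have [|d d0 H] := @continuous_gt_itv cos 0 (1 - eps) (@continuous_cos R 0).
    by rewrite cos0; lra.
  exists 0, d; split => //; lra.
have [|d d0 H] := @continuous_gt_itv sin (pi / 2) (1 - eps) (@continuous_sin R _).
  by rewrite sin_pihalf; lra.
exists (pi / 2), d; split => //; lra.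
Qed.

Lemma gibbs_kernel_ge0 J1 J2 beta L (A : set (spinconf R)) (w : spinconf R) :
  0 <= gibbs_kernel J1 J2 beta L A w.
Proof.
apply: divr_ge0; apply: integ_sites_ge0 => w'; rewrite ?mulr_ge0 ?expR_ge0//.
Qed.

(** The numerator is bounded by the least energy [E] on [A], the partition function from below by
    the arc configurations. [E0] only bounds the Boltzmann weight from above, as the arc estimate
    requires. *)
Lemma gibbs_kernel_le J1 J2 beta L (A : set (spinconf R)) (w : spinconf R) (a0 a1 E0 E E' : R) :
  unit_conf w -> 0 <= beta -> 0 <= a0 -> a0 < a1 -> a1 <= 2 * pi ->
  (forall w', unit_conf w' -> E0 <= H_Lambda J1 J2 L w') ->
  (forall w', unit_conf w' -> A w' -> E <= H_Lambda J1 J2 L w') ->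
  (forall w', unit_conf w' ->
    (forall s, s \in L -> exists2 t, a0 <= t <= a1 & w' s = unitvec t) ->
    H_Lambda J1 J2 L w' <= E') ->
  gibbs_kernel J1 J2 beta L A w <=
  expR (- beta * (E - E')) / ((a1 - a0) / (2 * pi)) ^+ size L.
Proof.
move=> uw b0 a00 a01 a1pi hE0 hE hE'; set c := (a1 - a0) / _.
have c0 : 0 < c ^+ size L.
  by rewrite exprn_gt0// divr_gt0 ?mulr_gt0 ?pi_gt0// subr_gt0.
have hnum : integ_sites L (fun eta => \1_A eta * boltz J1 J2 beta L eta) w
    <= expR (- beta * E).
  apply: integ_sites_le => // w'; first by rewrite mulr_ge0 ?expR_ge0.
  move=> uw'; rewrite indicE; have [|_] := boolP (w' \in A); last by rewrite mul0r expR_ge0.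
  by rewrite inE mul1r ler_expR => Aw'; rewrite ler_wnM2l ?oppr_le0// hE.
have hden : expR (- beta * E') * c ^+ size L <= integ_sites L (boltz J1 J2 beta L) w.
  apply: (@integ_sites_ge_arc _ _ _ (expR (- beta * E0))) => //.
  - by move=> w'; exact: expR_ge0.
  - by move=> w' uw'; rewrite ler_expR ler_wnM2l ?oppr_le0// hE0.
  - by move=> w' uw' al; rewrite ler_expR ler_wnM2l ?oppr_le0// hE'.
have den0 : 0 < expR (- beta * E') * c ^+ size L by rewrite mulr_gt0 ?expR_gt0.
apply: (@le_trans _ _ (expR (- beta * E) / (expR (- beta * E') * c ^+ size L))).
  apply: ler_pM => //; first by apply: integ_sites_ge0 => w'; rewrite mulr_ge0 ?expR_ge0.
    by rewrite invr_ge0 (le_trans _ hden)// ltW.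
  by rewrite lef_pV2// posrE (lt_le_trans den0).
by rewrite invfM mulrA -expRN -expRD ler_pM2r ?invr_gt0// ler_expR; lra.
Qed.

End GibbsBound.

(** * From a box to a single site *)

Lemma ler_sum_even (R : realType) (f : nat -> R) m : (forall i, 0 <= f i) ->
  \sum_(i < m) f i.*2 <= \sum_(i < m.*2) f i.
Proof.
move=> f0; elim: m => [|m IH]; first by rewrite !big_ord0.
rewrite doubleS !big_ord_recr/= -addrA lerD// lerDl f0//.
Qed.

Lemma ge0_sume_const (R : realType) (x : \bar R) n :
  (0 <= x -> \sum_(i < n) x = n%:R%:E * x)%E.
Proof.
move=> x0; elim: n => [|n IH]; first by rewrite big_ord0 mul0e.
by rewrite big_ord_recr/= IH -natr1 EFinD ge0_muleDl ?lee_fin// mul1e.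
Qed.

Section Main.
Variables (R : realType) (J1 J2 : R).
Hypotheses (J1_gt0 : 0 < J1) (J2_gt0 : 0 < J2).
Implicit Types (mu : probability (Omega R) R) (p : bool).

(** Restricted to even offsets from [r], where translation invariance gives every term the same
    expectation. *)
Definition even_sum p (r : site) (m : nat) (w : Omega R) : R :=
  \sum_(i < m) \sum_(j < m)
    spin_comp p ((w : spinconf R) (r.1 + i.*2%:Z, r.2 + j.*2%:Z)) ^+ 2.

Lemma even_sum_ge0 p r m w : 0 <= even_sum p r m w.
Proof. by apply: sumr_ge0 => i _; apply: sumr_ge0 => j _; rewrite sqr_ge0. Qed.

Lemma measurable_even_sum p r m : measurable_fun setT (even_sum p r m).
Proof.
apply: measurable_sum => i; apply: measurable_sum => j.
exact: measurable_comp_sqr.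
Qed.

Lemma even_sum_le_box p r m w : even_sum p r m w <=
  \sum_(i < m.*2) \sum_(j < m.*2)
    spin_comp p ((w : spinconf R) (r.1 + i%:Z, r.2 + j%:Z)) ^+ 2.
Proof.
pose g (i : nat) := \sum_(j < m.*2)
    spin_comp p ((w : spinconf R) (r.1 + i%:Z, r.2 + j%:Z)) ^+ 2.
apply: (@le_trans _ _ (\sum_(i < m) g i.*2)).
  apply: ler_sum => i _.
  apply: (@ler_sum_even _ (fun j => spin_comp p (w (r.1 + i.*2%:Z, r.2 + j%:Z)) ^+ 2)).
  by move=> j; rewrite sqr_ge0.
by apply: ler_sum_even => i; apply: sumr_ge0 => j _; rewrite sqr_ge0.
Qed.

Lemma even_sum_le p r m (w : Omega R) :
  unit_conf (w : spinconf R) -> even_sum p r m w <= m%:R ^+ 2.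
Proof.
move=> uw; rewrite expr2 natr_mul_sum; apply: ler_sum => i _.
rewrite -[m%:R]mulr1 natr_mul_sum; apply: ler_sum => j _.
exact: comp_sqr_le1.
Qed.

Lemma integral_even_sum mu p r m : transl_invariant mu ->
  (\int[mu]_w (even_sum p r m w)%:E =
   (m%:R ^+ 2)%:E * \int[mu]_w (spin_comp p ((w : spinconf R) r) ^+ 2)%:E)%E.
Proof.
move=> ti; rewrite /even_sum.
under eq_integral do rewrite -sumEFin.
rewrite ge0_integral_sum//; last 2 first.
- move=> i; apply/measurable_EFinP; apply: measurable_sum => j.
  exact: measurable_comp_sqr.
- by move=> i w _; rewrite lee_fin; apply: sumr_ge0 => j _; rewrite sqr_ge0.
have E0 : (0 <= \int[mu]_w (spin_comp p ((w : spinconf R) r) ^+ 2)%:E)%E.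
  by apply: integral_ge0 => w _; rewrite lee_fin sqr_ge0.
have H (i : 'I_m) : (\int[mu]_w (\sum_(j < m) spin_comp p
    ((w : spinconf R) (r.1 + i.*2%:Z, r.2 + j.*2%:Z)%R) ^+ 2)%:E =
    m%:R%:E * \int[mu]_w (spin_comp p ((w : spinconf R) r) ^+ 2)%:E)%E.
  under eq_integral do rewrite -sumEFin.
  rewrite ge0_integral_sum//; last 2 first.
  - by move=> j; apply/measurable_EFinP; exact: measurable_comp_sqr.
  - by move=> j w _; rewrite lee_fin sqr_ge0.
  under eq_bigr do rewrite integral_site_even_shift//.
  by rewrite ge0_sume_const.
under eq_bigr do rewrite H.
by rewrite ge0_sume_const ?mule_ge0 ?lee_fin// muleA -EFinM expr2.
Qed.

(** On the event the energy excess is of order [m ^ 2], while the boundary costs order [m]. The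
    constants [m], [C], [x] are fixed before [beta] and [r]. *)
Lemma gibbs_even_sum_tail p eta :
  coupling J1 J2 (~~ p) < coupling J1 J2 p -> 0 < eta ->
  exists m : nat, (0 < m)%N /\ exists2 C : R, 0 < C &
    exists2 x : R, 0 < x & forall beta, 0 <= beta -> forall r w, unit_conf w ->
      gibbs_kernel J1 J2 beta (box r m.*2)
        [set w | eta * m%:R ^+ 2 < even_sum (~~ p) r m w] w
      <= expR (- (beta * x)) / C.
Proof.
move=> gap eta0; set K := J1 + J2; set g := coupling J1 J2 p - coupling J1 J2 (~~ p).
have K0 : 0 < K by rewrite addr_gt0.
have g0 : 0 < g by rewrite subr_gt0.
have ge0 : 0 < g * eta by rewrite mulr_gt0.
(* With box side [2 * m], misalignment costs [10 * eps * K * (2 * m) ^ 2], half of the gain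
   [g * eta * m ^ 2]. *)
pose eps := g * eta / (80 * K).
have eps0 : 0 < eps by rewrite divr_gt0// mulr_gt0.
have epsE : eps * K = g * eta / 80.
  by rewrite /eps; field; apply/lt0r_neq0.
have [a0 [a1 [a00 a01 a1pi al]]] := aligned_arc p eps0.
(* Makes the boundary cost [24 * m * K] at most a quarter of the gain; the remaining quarter is the
   rate [x]. *)
pose m := (Num.truncn (96 * K / (g * eta))).+1.
have hm : 96 * K <= m%:R * (g * eta).
  by rewrite -ler_pdivrMr// ltW// truncnS_gt.
have m0 : 0 < m%:R :> R by rewrite ltr0n.
exists m; split => //.
exists (((a1 - a0) / (2 * pi)) ^+ (m.*2 * m.*2)).
  by rewrite exprn_gt0// divr_gt0 ?mulr_gt0 ?pi_gt0// subr_gt0.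
exists (g * eta / 4 * m%:R ^+ 2); first by rewrite mulr_gt0 ?exprn_gt0 ?divr_gt0.
move=> beta b0 r w uw.
pose n : R := (m.*2)%:R.
have nE : n = 2 * m%:R by rewrite /n -muln2 natrM mulrC.
pose E := - coupling J1 J2 p * n ^+ 2 + g * (eta * m%:R ^+ 2) - 4 * n * K.
pose E' := - coupling J1 J2 p * n ^+ 2 + 10 * eps * K * n ^+ 2 + 8 * n * K.
have hE0 w' : unit_conf w' -> - coupling J1 J2 p * n ^+ 2 - 4 * n * K <=
    H_Lambda J1 J2 (box r m.*2) w'.
  move=> uw'; apply: le_trans (box_energy_ge J1_gt0 J2_gt0 p r m.*2 uw').
  rewrite -/n -/K -/g lerD2r lerDl mulr_ge0 ?(ltW g0)//.
  by apply: sumr_ge0 => i _; apply: sumr_ge0 => j _; rewrite sqr_ge0.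
apply: (le_trans (@gibbs_kernel_le _ J1 J2 beta _ _ w a0 a1 _ E E'
  uw b0 a00 a01 a1pi hE0 _ _)); rewrite ?size_box.
- move=> w' uw' /= hA; apply: le_trans (box_energy_ge J1_gt0 J2_gt0 p r m.*2 uw').
  rewrite -/n -/K -/g /E lerD2r lerD2l ler_pM2l//.
  by apply: ltW; apply: lt_le_trans hA _; exact: even_sum_le_box.
- move=> w' uw' arc.
  apply: (@box_energy_le _ _ _ J1_gt0 J2_gt0 p w' r m.*2 eps) => //; first exact: ltW.
  by move=> s /arc[t ht ->]; exact: al.
rewrite ler_pM2r; last first.
  by rewrite invr_gt0 exprn_gt0// divr_gt0 ?mulr_gt0 ?pi_gt0// subr_gt0.
rewrite ler_expR mulNr lerN2 ler_wpM2l//.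
have -> : E - E' = g * eta * m%:R ^+ 2 - 10 * (eps * K) * n ^+ 2 - 12 * n * K.
  by rewrite /E /E'; ring.
rewrite nE epsE.
have : 96 * K * m%:R <= m%:R * (g * eta) * m%:R by rewrite ler_pM2r.
lra.
Qed.

Lemma minority_component_small p (delta : R) :
  coupling J1 J2 (~~ p) < coupling J1 J2 p -> 0 < delta ->
  exists beta0 : R, forall beta, beta0 <= beta -> forall mu,
    is_gibbs J1 J2 beta mu -> transl_invariant mu -> forall r,
    (\int[mu]_w (spin_comp (~~ p) ((w : spinconf R) r) ^+ 2)%:E <= delta%:E)%E.
Proof.
move=> gap d0; pose eta := delta / 2.
have eta0 : 0 < eta by rewrite divr_gt0.
have [m [m0 [C C0 [x x0 H]]]] := gibbs_even_sum_tail gap eta0.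
(* As [expR (beta * x)] is at least [beta * x], the tail bound is at most [(C * beta * x)^-1], hence
   at most [eta]. *)
exists (C * x * eta)^-1 => beta hb mu gmu ti r.
have cxe0 : 0 < C * x * eta by rewrite !mulr_gt0.
have b0 : 0 < beta by apply: lt_le_trans hb; rewrite invr_gt0.
set S := even_sum (~~ p) r m.
pose A : set (Omega R) := [set w | eta * m%:R ^+ 2 < S w].
have mA : measurable A.
  have -> : A = setT `&` S @^-1` `]eta * m%:R ^+ 2, +oo[%classic.
    by apply/seteqP; split => w /=; rewrite in_itv/= andbT; [|case].
  by apply: measurable_even_sum => //; exact: measurable_itv.
have N0 := gibbs_non_unit gmu.
have muA : (mu A <= eta%:E)%E.
  rewrite (gmu (box r m.*2) (uniq_box r m.*2) A mA).
  apply: (@le_trans _ _ (\int[mu]_w (cst eta%:E w))%E); last first.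
    by rewrite integral_cst//= probability_setT mule1.
  apply: (nonmeas_ae_le_integral (@measurable_non_unit R) N0) => //.
  - by move=> w; rewrite lee_fin gibbs_kernel_ge0.
  - by move=> w; rewrite lee_fin ltW.
  move=> w /contrapT uw; rewrite lee_fin.
  apply: le_trans (H _ (ltW b0) r _ uw) _.
  rewrite ler_pdivrMr// expRN -[leRHS]invrK lef_pV2 ?posrE ?expR_gt0 ?invr_gt0 ?mulr_gt0//.
  apply: (@le_trans _ _ (beta * x)); last first.
    by apply: le_trans (expR_ge1Dx _); rewrite lerDr.
  rewrite -ler_pdivrMr// -invfM; apply: le_trans hb.
  by rewrite mulrC [eta * C]mulrC mulrA [x * C]mulrC.
have m20 : 0 < m%:R ^+ 2 :> R by rewrite exprn_gt0// ltr0n.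
rewrite -(@lee_pmul2l _ (m%:R ^+ 2)%:E)//.
rewrite -integral_even_sum//.
(* Off [A] the sum is at most [eta * m ^ 2], on [A] at most [m ^ 2]; with the measure of [A] at most
   [eta], the two parts make up [delta]. *)
apply: (@le_trans _ _ (\int[mu]_w ((eta * m%:R ^+ 2)%:E + (m%:R ^+ 2)%:E * (\1_A w)%:E))%E).
  apply: (nonmeas_ae_le_integral (@measurable_non_unit R) N0).
  - apply: emeasurable_funD => //; apply: measurable_funeM.
    exact/measurable_EFinP/measurable_indic.
  - by move=> w; rewrite lee_fin even_sum_ge0.
  - by move=> w; rewrite -EFinM -EFinD lee_fin addr_ge0// ltW// mulr_gt0.
  move=> w /contrapT uw; rewrite -EFinM -EFinD lee_fin indicE.
  have [_|] := boolP (w \in A).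
    rewrite mulr1; apply: le_trans (even_sum_le _ _ _ uw) _.
    by rewrite lerDr ltW// mulr_gt0.
  by move/negP; rewrite inE /A/= mulr0 addr0 => /negP; rewrite -leNgt.
rewrite ge0_integralD//; last 2 first.
- by move=> w _; rewrite lee_fin ltW// mulr_gt0.
- apply: measurable_funeM; exact/measurable_EFinP/measurable_indic.
rewrite integral_cst//= probability_setT mule1 ge0_integralZl//; last first.
- exact/measurable_EFinP/measurable_indic.
rewrite integral_indic// setIT.
apply: (@le_trans _ _ ((eta * m%:R ^+ 2)%:E + (m%:R ^+ 2)%:E * eta%:E)%E).
  by rewrite leeD2l// lee_pmul2l.
by rewrite -!EFinM -EFinD lee_fin /eta; lra.
Qed.

(** The two squared components add up to 1 almost surely, so the bound on the minority one passes to
    the majority. *)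
Lemma majority_component_large p (delta : R) :
  coupling J1 J2 (~~ p) < coupling J1 J2 p -> 0 < delta ->
  exists beta0 : R, forall beta, beta0 <= beta -> forall mu,
    is_gibbs J1 J2 beta mu -> transl_invariant mu ->
    forall r, ((1 - delta)%:E <=
               \int[mu]_w (spin_comp p ((w : spinconf R) r) ^+ 2)%:E)%E.
Proof.
move=> gap d0; have [beta0 H] := minority_component_small gap d0.
exists beta0 => beta hb mu gmu ti r.
have {}H := H _ hb _ gmu ti r.
have mq b : measurable_fun setT
    (fun w : Omega R => (spin_comp b ((w : spinconf R) r) ^+ 2)%:E).
  by apply/measurable_EFinP; exact: measurable_comp_sqr.
have : (1%:E <= \int[mu]_w ((spin_comp p ((w : spinconf R) r) ^+ 2)%:E +
    (spin_comp (~~ p) ((w : spinconf R) r) ^+ 2)%:E))%E.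
  apply: (@le_trans _ _ (\int[mu]_w (cst 1%:E w))%E).
    by rewrite integral_cst//= probability_setT mule1.
  apply: (nonmeas_ae_le_integral (@measurable_non_unit R) (gibbs_non_unit gmu)).
  - exact: emeasurable_funD.
  - by move=> w; rewrite lee_fin.
  - by move=> w; rewrite -EFinD lee_fin addr_ge0// sqr_ge0.
  by move=> w /contrapT uw; rewrite -EFinD lee_fin (comp_sqr p (uw r)) subrK.
rewrite ge0_integralD//; last 2 first.
- by move=> w _; rewrite lee_fin sqr_ge0.
- by move=> w _; rewrite lee_fin sqr_ge0.
move=> h1; rewrite EFinB leeBlDr//; apply: le_trans h1 _.
by rewrite leeD2l.
Qed.

End Main.

Theorem theorem2p4 (R : realType) (J1 J2 : R) :
  (0 < J2 -> J2 < J1 ->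
   forall delta : R, 0 < delta ->
   exists beta0 : R, forall beta : R, beta0 <= beta ->
   forall mu : probability (Omega R) R,
     is_gibbs J1 J2 beta mu -> transl_invariant mu -> ergodic mu ->
     forall r : site,
       ((1 - delta)%:E <= \int[mu]_w (((w : spinconf R) r).1 ^+ 2)%:E)%E)
  /\
  (0 < J1 -> J1 < J2 ->
   forall delta : R, 0 < delta ->
   exists beta0 : R, forall beta : R, beta0 <= beta ->
   forall mu : probability (Omega R) R,
     is_gibbs J1 J2 beta mu -> transl_invariant mu -> ergodic mu ->
     forall r : site,
       ((1 - delta)%:E <= \int[mu]_w (((w : spinconf R) r).2 ^+ 2)%:E)%E).
Proof.
split=> [J2_gt0 J21|J1_gt0 J12] delta d0.
  have J1_gt0 := lt_trans J2_gt0 J21.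
  have [beta0 H] := @majority_component_large R J1 J2 J1_gt0 J2_gt0 true delta J21 d0.
  by exists beta0 => beta hb mu gmu ti _ r; exact: (H beta hb mu gmu ti r).
have J2_gt0 := lt_trans J1_gt0 J12.
have [beta0 H] := @majority_component_large R J1 J2 J1_gt0 J2_gt0 false delta J12 d0.
by exists beta0 => beta hb mu gmu ti _ r; exact: (H beta hb mu gmu ti r).
Qed.
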